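(* Let $R=\mathbb{Z}[\xi]$, let $\mathcal{H}_3$ be the Hecke algebra of $S_3$ over $R$ with Jucys--Murphy elements $L_1,L_2,L_3$, and let $M_\xi=\{m_\lambda(L_1,L_2,L_3)\mid \lambda \text{ a partition with } \ell(\lambda)\le 3\}$. Then the only subset of $M_\xi$ that is an $R$-basis for the centre $Z(\mathcal{H}_3)$ is $\{m_\emptyset,m_1,m_{1,1}\}$.
   Context: **Hecke algebra.** $S_3$ is generated by $s_1=(1\ 2)$, $s_2=(2\ 3)$, with Coxeter length function $\ell$. $\mathcal{H}_3$ is the unital associative $R$-algebra, free as an $R$-module with basis $\{\tilde T_w\mid w\in S_3\}$, where $\tilde T_w=\tilde T_{s_{i_1}}\cdots\tilde T_{s_{i_r}}$ for a reduced expression $w=s_{i_1}\cdots s_{i_r}$, with multiplication determined for $w\in S_3$, $s\in\{s_1,s_2\}$ by $$\tilde T_w\tilde T_s=\begin{cases}\tilde T_{ws}+\xi\tilde T_w&\text{if }\ell(ws)<\ell(w),\\ \tilde T_{ws}&\text{otherwise.}\end{cases}$$ The Jucys--Murphy elements are $L_1=0$, $L_2=\tilde T_{s_1}$, $L_3=\tilde T_{s_1s_2s_1}+\tilde T_{s_2}$; they commute, and symmetric polynomials in them lie in $Z(\mathcal{H}_3)$. **Monomial symmetric polynomials.** A partition $\lambda=(\lambda_1,\dots,\lambda_r)$ is a weakly decreasing finite sequence of positive integers, with $\ell(\lambda)=r$; the empty partition $\emptyset$ is allowed. For $r\le 3$, $m_\lambda(X_1,X_2,X_3)$ is the sum of all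 distinct monomials of the form $X_{\sigma(1)}^{\lambda_1}\cdots X_{\sigma(r)}^{\lambda_r}$, $\sigma\in S_3$ (each with coefficient $1$), and $m_\emptyset=1$. We write $m_{\lambda_1,\dots,\lambda_r}$ for $m_\lambda(L_1,L_2,L_3)$. *)

(* Defs.v *)
From HB Require Import structures.
From mathcomp Require Import all_boot all_order all_algebra all_fingroup.
From mathcomp Require Import boolp classical_sets.
From mathcomp Require Import mpoly.
From mathcomp Require Import ring.

Set Implicit Arguments.
Unset Strict Implicit.
Unset Printing Implicit Defensive.

Import GRing.Theory.
Local Open Scope classical_set_scope.
Local Open Scope ring_scope.

Definition lin_indep (R : nzRingType) (V : lmodType R) (B : set V) : Prop :=
  forall (s : seq V) (c : V -> R),
    uniq s -> (forall x, x \in s -> B x) ->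
    \sum_(x <- s) c x *: x = 0 -> forall x, x \in s -> c x = 0.

Definition lin_span (R : nzRingType) (V : lmodType R) (B : set V) : set V :=
  [set v | exists (s : seq V) (c : V -> R),
     (forall x, x \in s -> B x) /\ v = \sum_(x <- s) c x *: x].

(* [B] may a priori be infinite; [M] is meant to be a submodule of [V]. *)
Definition is_basis (R : nzRingType) (V : lmodType R) (B M : set V) : Prop :=
  [/\ B `<=` M, lin_indep B & M `<=` lin_span B].

Lemma is_basis_range (I : finType) (R : nzRingType) (V : lmodType R) (F : I -> V) :
  injective F ->
  (forall c : I -> R, \sum_i c i *: F i = 0 -> forall i, c i = 0) ->
  (forall v, exists c : I -> R, v = \sum_i c i *: F i) ->
  is_basis (range F) [set: V].
Proof.
move=> Finj indep span; split=> // [s c us sF s0 x xs|v _].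
- have ps : perm_eq s [seq F i | i <- enum I & F i \in s].
    apply: uniq_perm => [//||y].
      by rewrite map_inj_uniq // filter_uniq // enum_uniq.
    apply/idP/mapP => [ys|[i]]; last by rewrite mem_filter => /andP[? _] ->.
    have [i _ Fi] := sF y ys; exists i => //.
    by rewrite mem_filter Fi ys mem_enum.
  pose d i := if F i \in s then c (F i) else 0.
  have [i _ Fi] := sF x xs; have := indep d _ i; rewrite /d Fi xs; apply.
  move: s0; rewrite (perm_big _ ps) big_map big_filter big_enum_cond big_mkcond /=.
  move=> {2}<-.
  by apply: eq_bigr => j _; case: ifP => // _; rewrite scale0r.
- have [c ->] := span v; exists [seq F i | i <- enum I].
  exists (fun v => if [pick i | F i == v] is Some i then c i else 0).
  split=> [_ /mapP[i _ ->]|]; first by exists i.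
  rewrite big_map big_enum; apply: eq_bigr => i _.
  by case: pickP => [j /eqP/Finj -> //|/(_ i)]; rewrite eqxx.
Qed.

Definition ring_center (A : nzRingType) : set A :=
  [set z | forall a, z * a = a * z].
Arguments ring_center : clear implicits.

(* The points 1, 2, 3 permuted by S_3 are the ordinals 0, 1, 2. *)
Definition s1 : 'S_3 := tperm (inord 0) (inord 1).
Definition s2 : 'S_3 := tperm (inord 1) (inord 2).
Definition is_word (e : seq 'S_3) : bool := all (mem [:: s1; s2]) e.

Section S3.
Local Open Scope group_scope.

Let o0 : 'I_3 := inord 0.
Let o1 : 'I_3 := inord 1.
Let o2 : 'I_3 := inord 2.

Lemma ord3P (i : 'I_3) : [\/ i = o0, i = o1 | i = o2].
Proof.
by case: i => [[|[|[|]]] // hi]; [apply: Or31|apply: Or32|apply: Or33];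
  apply/val_inj; rewrite /= inordK.
Qed.

Let o01 : (o0 == o1) = false. Proof. by rewrite -val_eqE /= !inordK. Qed.
Let o02 : (o0 == o2) = false. Proof. by rewrite -val_eqE /= !inordK. Qed.
Let o12 : (o1 == o2) = false. Proof. by rewrite -val_eqE /= !inordK. Qed.
Let oE := (o01, o02, o12, eq_sym o1 o0, eq_sym o2 o0, eq_sym o2 o1, eqxx).

Let s10 : s1 o0 = o1. Proof. by rewrite /s1 permE /= eqxx. Qed.
Let s11 : s1 o1 = o0. Proof. by rewrite /s1 permE /= !oE. Qed.
Let s12 : s1 o2 = o2. Proof. by rewrite /s1 permE /= !oE. Qed.
Let s20 : s2 o0 = o0. Proof. by rewrite /s2 permE /= !oE. Qed.
Let s21 : s2 o1 = o2. Proof. by rewrite /s2 permE /= eqxx. Qed.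
Let s22 : s2 o2 = o1. Proof. by rewrite /s2 permE /= !oE. Qed.
Let sE := (s10, s11, s12, s20, s21, s22, permM, perm1).

Let permS3 (u v : 'S_3) : u o0 = v o0 -> u o1 = v o1 -> u o2 = v o2 -> u = v.
Proof. by move=> h0 h1 h2; apply/permP => i; case: (ord3P i) => ->. Qed.

Definition S3_words : seq (seq 'S_3) :=
  [:: [::]; [:: s1]; [:: s2]; [:: s1; s2]; [:: s2; s1]; [:: s1; s2; s1]].

Lemma S3_enum (w : 'S_3) : exists2 e, e \in S3_words & w = \prod_(s <- e) s.
Proof.
have inj i j : (w i == w j) = (i == j) by rewrite (inj_eq perm_inj).
have := inj o0 o1; have := inj o0 o2; have := inj o1 o2.
case: (ord3P (w o0)) => w0; case: (ord3P (w o1)) => w1;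
  case: (ord3P (w o2)) => w2; rewrite w0 w1 w2 !oE // => _ _ _;
  [exists [::] | exists [:: s2] | exists [:: s1] | exists [:: s2; s1]
  | exists [:: s1; s2] | exists [:: s1; s2; s1]];
  first [by rewrite /S3_words !inE ?eqxx ?orbT
        | by rewrite ?big_cons big_nil; apply: permS3; rewrite !sE].
Qed.

Lemma word_exists (w : 'S_3) :
  exists n, [exists e : n.-tuple 'S_3, is_word e && (\prod_(s <- e) s == w)].
Proof.
have [e he ->] := S3_enum w; exists (size e); apply/existsP.
exists (in_tuple e); rewrite eqxx andbT.
have /allP words : all is_word S3_words.
  by rewrite /is_word /= !inE ?eqxx ?orbT.
exact: words he.
Qed.

Definition S3_elts : seq 'S_3 :=
  [:: 1; s1; s2; s1 * s2; s2 * s1; s1 * s2 * s1].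

Lemma S3_eltsP (w : 'S_3) : w \in S3_elts.
Proof.
have [e he ->] := S3_enum w.
have /allP prods : all (fun e => \prod_(s <- e) s \in S3_elts) S3_words.
  by rewrite /= !big_cons !big_nil !mulg1 !mulgA !inE !eqxx ?orbT.
exact: prods he.
Qed.

Lemma S3_elts_uniq : uniq S3_elts.
Proof.
apply: (@map_uniq _ _ (fun w : 'S_3 => (w o0, w o1))).
by rewrite /= !inE !sE !xpair_eqE !oE.
Qed.

Lemma s1K : s1 * s1 = 1. Proof. exact: tperm2. Qed.
Lemma s2K : s2 * s2 = 1. Proof. exact: tperm2. Qed.
Lemma s121 : s2 * s1 * s2 = s1 * s2 * s1.
Proof. by apply: permS3; rewrite !sE. Qed.

End S3.

(* Coxeter length: least number of factors in a word in s1, s2 with value w. *)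
Definition coxlen (w : 'S_3) : nat := ex_minn (word_exists w).

Section CoxLen.
Local Open Scope group_scope.

Lemma coxlen_word (w : 'S_3) :
  exists e, [/\ is_word e, \prod_(s <- e) s = w & size e = coxlen w].
Proof.
rewrite /coxlen; case: ex_minnP => n /existsP[e /andP[we /eqP pe]] _.
by exists e; rewrite size_tuple.
Qed.

Lemma coxlen_le (e : seq 'S_3) : is_word e -> (coxlen (\prod_(s <- e) s) <= size e)%N.
Proof.
move=> we; rewrite /coxlen; case: ex_minnP => n _; apply.
by apply/existsP; exists (in_tuple e); rewrite /= we eqxx.
Qed.

Lemma coxlen_mulr (w s : 'S_3) :
  s \in [:: s1; s2] -> (coxlen (w * s) <= (coxlen w).+1)%N.
Proof.
move=> hs; have [e [we <- <-]] := coxlen_word w.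
have := @coxlen_le (rcons e s); rewrite -cats1 big_cat big_seq1 size_cat addn1.
by apply; rewrite /is_word all_cat /= hs; move: we; rewrite /is_word => ->.
Qed.

Lemma coxlen_S3 : map coxlen S3_elts = [:: 0; 1; 1; 2; 2; 3]%N.
Proof.
have short (e : seq 'S_3) : is_word e ->
    [/\ size e = 0%N -> \prod_(s <- e) s = 1,
        size e = 1%N -> \prod_(s <- e) s \in [:: s1; s2]
      & size e = 2 -> \prod_(s <- e) s \in [:: 1; s1 * s2; s2 * s1]].
  case: e => [|x [|y [|z e]]] // => [_|/andP[hx _]|/and3P[hx hy _]];
    rewrite ?big_nil ?big_seq1 //; split=> // _; rewrite !big_cons big_nil mulg1.
  by move: hx hy; rewrite !inE => /orP[]/eqP-> /orP[]/eqP->;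
    rewrite ?s1K ?s2K eqxx ?orbT.
have lenE e n : is_word e -> size e = n -> (forall e', is_word e' ->
    \prod_(s <- e') s = \prod_(s <- e) s -> (n <= size e')%N) ->
    coxlen (\prod_(s <- e) s) = n.
  move=> we <- hn; apply/eqP; rewrite eqn_leq coxlen_le //=.
  have [e' [we' pe' <-]] := coxlen_word (\prod_(s <- e) s).
  exact: hn we' pe'.
have := S3_elts_uniq; rewrite /= !inE !negb_or.
case/and5P=> /and5P[a1 a2 a3 a4 a5] /and4P[b1 b2 b3 b4] /and3P[c1 c2 c3]
  /andP[d1 d2] /andP[f1 _].
have le e' w n : is_word e' -> \prod_(s <- e') s = w ->
   ((w != 1) || (n <= 0)%N) -> ((w \notin [:: s1; s2]) || (n <= 1)%N) ->
   ((w \notin [:: 1; s1 * s2; s2 * s1]) || (n <= 2)%N) -> (n <= 3)%N ->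
   (n <= size e')%N.
  move=> we' pe'; have [] := short e' we'; rewrite pe'.
  case: (size e') => [|[|[|m]]] h0 h1 h2.
  - by rewrite h0 // eqxx.
  - by rewrite h1.
  - by rewrite h2.
  - by move=> _ _ _ /leq_trans; apply.
have P0 : coxlen 1 = 0%N.
  by have := lenE [::] 0%N isT erefl; rewrite big_nil; apply.
have ord w : w \in [:: s1; s2] -> w != 1 -> coxlen w = 1%N.
  move=> hw w1; have := lenE [:: w] 1%N; rewrite big_seq1; apply=> //.
    by rewrite /is_word /= hw.
  by move=> e' we' pe'; apply: (le e' w) => //; rewrite ?w1 ?orbT.
have h1 : s1 \in [:: s1; s2] by rewrite inE eqxx.
have h2 : s2 \in [:: s1; s2] by rewrite !inE eqxx orbT.
congr [:: _; _; _; _; _; _] => //.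
- by apply: ord; rewrite // eq_sym.
- by apply: ord; rewrite // eq_sym.
- have := lenE [:: s1; s2] 2%N; rewrite !big_cons big_nil mulg1; apply=> //.
    by rewrite /is_word /= h1 h2.
  move=> e' we' pe'; apply: (le e' (s1 * s2)); rewrite ?orbT // ?(eq_sym _ 1) ?a3 //.
  by rewrite !inE negb_or !(eq_sym (s1 * s2)) b2 c1.
- have := lenE [:: s2; s1] 2%N; rewrite !big_cons big_nil mulg1; apply=> //.
    by rewrite /is_word /= h1 h2.
  move=> e' we' pe'; apply: (le e' (s2 * s1)); rewrite ?orbT // ?(eq_sym _ 1) ?a4 //.
  by rewrite !inE negb_or !(eq_sym (s2 * s1)) b3 c2.
have := lenE [:: s1; s2; s1] 3%N; rewrite !big_cons big_nil mulg1 mulgA; apply=> //.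
  by rewrite /is_word /= h1 h2.
move=> e' we' pe'; apply: (le e' (s1 * s2 * s1)); rewrite // ?(eq_sym _ 1) ?a5 //.
  by rewrite !inE negb_or !(eq_sym (s1 * s2 * s1)) b4 c3.
by rewrite !inE !negb_or !(eq_sym (s1 * s2 * s1)) a5 d2 f1.
Qed.

End CoxLen.

(* [H] with basis [T] is the Hecke algebra of S_3 over Z[xi], where xi is the
   variable 'X. In MathComp (u * v) i = v (u i) for permutations; passing to the
   opposite convention amounts to replacing T by w |-> T w^-1, which changes
   neither the algebra nor its Jucys--Murphy elements. *)
Record hecke3 (H : algType {poly int}) (T : 'S_3 -> H) : Prop := Hecke3 {
  hecke3_inj : injective T;
  hecke3_basis : is_basis (range T) [set: H];
  hecke3_reduced : forall e : seq 'S_3,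
    is_word e -> size e = coxlen (\prod_(s <- e) s)%g ->
    T (\prod_(s <- e) s)%g = \prod_(s <- e) T s;
  hecke3_mul : forall w s : 'S_3, s \in [:: s1; s2] ->
    T w * T s = if (coxlen (w * s)%g < coxlen w)%N
                then T (w * s)%g + 'X *: T w else T (w * s)%g }.

Definition JM (H : algType {poly int}) (T : 'S_3 -> H) (i : 'I_3) : H :=
  nth 0 [:: 0; T s1; T (s1 * s2 * s1)%g + T s2] i.

Definition is_partition (lam : seq nat) : bool :=
  sorted geq lam && all (leq 1) lam.

(* The exponent of the variable X_i in X_(sigma 1)^(lam_1) ... X_(sigma r)^(lam_r)
   is lam_(sigma^-1 i), and 0 when sigma^-1 i > r. *)
Definition monom_of (lam : seq nat) (sigma : 'S_3) : 'X_{1..3} :=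
  [multinom nth 0%N lam ((sigma^-1)%g i) | i < 3].

Definition monsym (lam : seq nat) : {mpoly {poly int}[3]} :=
  \sum_(m <- undup [seq monom_of lam sigma | sigma : 'S_3]) 'X_[m].

(* The L_i commute, so the order of the factors in [mmap] is immaterial. *)
Definition mJM (H : algType {poly int}) (T : 'S_3 -> H) (lam : seq nat) : H :=
  mmap (in_alg H) (JM T) (monsym lam).

Definition Mxi (H : algType {poly int}) (T : 'S_3 -> H) : set H :=
  [set mJM T lam | lam in [set lam | is_partition lam && (size lam <= 3)%N]].

(* Existence of the Hecke algebra, so that [hecke3] is not vacuous: R^6 with
   coordinates along 1, s1, s2, s1 s2, s2 s1, s1 s2 s1. *)
Module Hecke3Model.
Local Notation R := {poly int}.

Definition carrier : Type := ((R * R * R) * (R * R * R))%type.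
HB.instance Definition _ := GRing.Zmodule.on carrier.

Definition mk (a b c d e f : R) : carrier := ((a, b, c), (d, e, f)).
Definition ext (k : R -> R -> R) (u v : carrier) : carrier :=
  let: ((a, b, c), (d, e, f)) := u in let: ((a', b', c'), (d', e', f')) := v in
  mk (k a a') (k b b') (k c c') (k d d') (k e e') (k f f').
Definition scale (x : R) (u : carrier) : carrier :=
  let: ((a, b, c), (d, e, f)) := u in
  mk (x * a) (x * b) (x * c) (x * d) (x * e) (x * f).
Definition r1 (u : carrier) : carrier :=
  let: ((a, b, c), (d, e, f)) := u in
  mk b (a + 'X * b) e f (c + 'X * e) (d + 'X * f).
Definition r2 (u : carrier) : carrier :=
  let: ((a, b, c), (d, e, f)) := u in
  mk c d (a + 'X * c) (b + 'X * d) f (e + 'X * f).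
Definition add := ext +%R.
Definition mul (u v : carrier) : carrier :=
  let: ((a, b, c), (d, e, f)) := v in
  add (scale a u) (add (scale b (r1 u)) (add (scale c (r2 u))
  (add (scale d (r2 (r1 u))) (add (scale e (r1 (r2 u)))
       (scale f (r1 (r2 (r1 u)))))))).
Definition one : carrier := mk 1 0 0 0 0 0.

Lemma addE (u v : carrier) : u + v = add u v.
Proof. by case: u => [[[a b] c] [[d e] f]]; case: v => [[[? ?] ?] [[? ?] ?]]. Qed.

Local Ltac crush := rewrite ?addE; congr (((_, _), _), ((_, _), _)); rewrite /=; ring.

Lemma mulA : associative mul. Proof.
move=> [[[a1 b1] c1] [[d1 e1] f1]] [[[a2 b2] c2] [[d2 e2] f2]] [[[a3 b3] c3] [[d3 e3] f3]]; crush. Qed.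
Lemma mul1l : left_id one mul. Proof.
move=> [[[a1 b1] c1] [[d1 e1] f1]]; crush. Qed.
Lemma mul1r : right_id one mul. Proof.
move=> [[[a1 b1] c1] [[d1 e1] f1]]; crush. Qed.
Lemma mulDl : left_distributive mul +%R. Proof.
move=> [[[a1 b1] c1] [[d1 e1] f1]] [[[a2 b2] c2] [[d2 e2] f2]] [[[a3 b3] c3] [[d3 e3] f3]]; crush. Qed.
Lemma mulDr : right_distributive mul +%R. Proof.
move=> [[[a1 b1] c1] [[d1 e1] f1]] [[[a2 b2] c2] [[d2 e2] f2]] [[[a3 b3] c3] [[d3 e3] f3]]; crush. Qed.
Lemma one_neq0 : one != 0 :> carrier.
Proof. by apply/eqP => -[] /eqP; rewrite oner_eq0. Qed.

HB.instance Definition _ := GRing.Zmodule_isNzRing.Build carrier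
  mulA mul1l mul1r mulDl mulDr one_neq0.

Lemma scaleA x y (u : carrier) : scale x (scale y u) = scale (x * y) u.
Proof. case: u => [[[a1 b1] c1] [[d1 e1] f1]]; crush. Qed.
Lemma scale1 : left_id 1 scale.
Proof. move=> [[[a1 b1] c1] [[d1 e1] f1]]; crush. Qed.
Lemma scaleDr : right_distributive scale +%R.
Proof. move=> x [[[a1 b1] c1] [[d1 e1] f1]] [[[a2 b2] c2] [[d2 e2] f2]]; crush. Qed.
Lemma scaleDl (u : carrier) : {morph scale^~ u : x y / x + y}.
Proof. move=> x y; case: u => [[[a1 b1] c1] [[d1 e1] f1]]; crush. Qed.

HB.instance Definition _ := GRing.Zmodule_isLmodule.Build R carrier
  scaleA scale1 scaleDr scaleDl.

Lemma scaleAl (x : R) (u v : carrier) : x *: (u * v) = (x *: u) * v.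
Proof.
rewrite /GRing.scale /= /GRing.mul /=.
by move: u v => [[[a1 b1] c1] [[d1 e1] f1]] [[[a2 b2] c2] [[d2 e2] f2]]; crush.
Qed.
Lemma scaleAr (x : R) (u v : carrier) : x *: (u * v) = u * (x *: v).
Proof.
rewrite /GRing.scale /= /GRing.mul /=.
by move: u v => [[[a1 b1] c1] [[d1 e1] f1]] [[[a2 b2] c2] [[d2 e2] f2]]; crush.
Qed.

HB.instance Definition _ := GRing.Lmodule_isLalgebra.Build R carrier scaleAl.
HB.instance Definition _ := GRing.Lalgebra_isAlgebra.Build R carrier scaleAr.

Lemma mulE (u v : carrier) : u * v = mul u v. Proof. by []. Qed.
Lemma scaleE (x : R) (u : carrier) : x *: u = scale x u. Proof. by []. Qed.

Definition basis : seq carrier :=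
  [:: mk 1 0 0 0 0 0; mk 0 1 0 0 0 0; mk 0 0 1 0 0 0;
      mk 0 0 0 1 0 0; mk 0 0 0 0 1 0; mk 0 0 0 0 0 1].
Definition T (w : 'S_3) : carrier := nth 0 basis (index w S3_elts).

Lemma TE : map T S3_elts = basis.
Proof.
apply: (@eq_from_nth _ 0) => // i; rewrite size_map => hi.
by rewrite (nth_map 1%g) // /T index_uniq // S3_elts_uniq.
Qed.

Lemma Tmul (w s : 'S_3) : s \in [:: s1; s2] ->
  T w * T s = if (coxlen (w * s)%g < coxlen w)%N
              then T (w * s)%g + 'X *: T w else T (w * s)%g.
Proof.
have [l0 l1 l2 l3 l4 l5] := coxlen_S3; have [t0 t1 t2 t3 t4 t5] := TE.
have p11 := s1K; have p22 := s2K.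
have p121 : (s2 * s1 * s2 = s1 * s2 * s1)%g by exact: s121.
have p212 : (s1 * s2 * s1 * s2 = s2 * s1)%g.
  by rewrite -p121 -mulgA p22 mulg1.
have p122 : (s1 * s2 * s2 = s1)%g by rewrite -mulgA p22 mulg1.
have p211 : (s2 * s1 * s1 = s2)%g by rewrite -mulgA p11 mulg1.
have p1211 : (s1 * s2 * s1 * s1 = s1 * s2)%g by rewrite -mulgA p11 mulg1.
have := S3_eltsP w; rewrite /S3_elts !inE => hw hs.
move: hw; do ![case/orP]; move/eqP->; move: hs; case/orP; move/eqP->;
  rewrite ?mul1g ?p1211 ?p212 ?p11 ?p22 ?p122 ?p211 ?p121 ?l0 ?l1 ?l2 ?l3 ?l4 ?l5 /=
    ?t0 ?t1 ?t2 ?t3 ?t4 ?t5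
    ?scaleE mulE; crush.
Qed.

Lemma T_reduced (e : seq 'S_3) :
  is_word e -> size e = coxlen (\prod_(s <- e) s)%g ->
  T (\prod_(s <- e) s)%g = \prod_(s <- e) T s.
Proof.
elim/last_ind: e => [_ _|e s IHe].
  by rewrite !big_nil; have [] := TE.
rewrite /is_word all_rcons => /andP[hs we] he.
have pe : (\prod_(t <- rcons e s) t = (\prod_(t <- e) t) * s)%g.
  by rewrite -cats1 big_cat big_seq1.
rewrite size_rcons pe in he.
have le1 := coxlen_le we; have := coxlen_mulr (\prod_(t <- e) t)%g hs.
rewrite -he ltnS => le2.
have eqe : size e = coxlen (\prod_(t <- e) t)%g by apply/eqP; rewrite eqn_leq le1 le2.
rewrite pe -cats1 big_cat big_seq1 /= -IHe // Tmul // -he -eqe.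
by rewrite ltnNge leqnSn.
Qed.

Lemma T_inj : injective T.
Proof.
move=> u v; rewrite /T => /eqP; rewrite nth_uniq ?index_mem ?S3_eltsP //.
  by move=> /eqP h; rewrite -(nth_index 1%g (S3_eltsP u)) h nth_index ?S3_eltsP.
by rewrite /basis /mk /= !inE !xpair_eqE !oner_eq0 ?eqxx
  !(eq_sym 0 (1 : R)) !oner_eq0 ?andbF.
Qed.

Lemma sumT (c : 'S_3 -> R) :
  \sum_w c w *: T w = mk (c 1%g) (c s1) (c s2) (c (s1 * s2)%g) (c (s2 * s1)%g)
                        (c (s1 * s2 * s1)%g).
Proof.
rewrite (perm_big S3_elts) /=; last first.
  by apply: uniq_perm; rewrite ?S3_elts_uniq ?index_enum_uniq // => w;
     rewrite mem_index_enum S3_eltsP.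
have [t0 t1 t2 t3 t4 t5] := TE.
rewrite !big_cons big_nil t0 t1 t2 t3 t4 t5 addr0 !scaleE; crush.
Qed.

Lemma T_basis : is_basis (range T) [set: carrier].
Proof.
apply: is_basis_range T_inj _ _ => [c|[[[a b] d] [[e f] g]]].
  rewrite sumT => -[c0 c1 c2 c3 c4 c5] w.
  have := S3_eltsP w; rewrite /S3_elts !inE.
  by do ![case/orP]; move/eqP->.
exists (fun w => nth 0 [:: a; b; d; e; f; g] (index w S3_elts)).
have ix i : (i < 6)%N -> index (nth 1%g S3_elts i) S3_elts = i.
  by move=> ?; rewrite index_uniq // S3_elts_uniq.
rewrite sumT.
by rewrite (ix 0%N isT) (ix 1%N isT) (ix 2%N isT) (ix 3%N isT) (ix 4%N isT)
  (ix 5%N isT).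
Qed.
Definition alg : algType R := carrier.

End Hecke3Model.

Lemma hecke3_exists : exists (H : algType {poly int}) (T : 'S_3 -> H), hecke3 T.
Proof.
exists Hecke3Model.alg, Hecke3Model.T; split.
- exact: Hecke3Model.T_inj.
- exact: Hecke3Model.T_basis.
- exact: Hecke3Model.T_reduced.
- exact: Hecke3Model.Tmul.
Qed.

(* Main.v *)
Require Import Defs.
From mathcomp Require Import all_boot all_order all_algebra all_fingroup.
From mathcomp Require Import boolp classical_sets.
From mathcomp Require Import mpoly.
From mathcomp Require Import ring zify.

Import Order.TTheory GRing.Theory Num.Theory.
Local Open Scope classical_set_scope.
Local Open Scope ring_scope.

(* The centre has basis 1, x, y with x = L2 + L3 = m_1 and y = L2 L3 = m_(1,1). A
   subset of [Mxi] is a basis iff its coordinate matrix P over 1, x, y is a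
   square matrix with unit determinant, and then det P remains a unit after
   specializing xi to an integer. At xi = 0 the algebra is the group ring of S_3,
   where the characters of all m_lambda are explicit in terms of powers of 2: each
   m_lambda is there either a multiple of x or a combination of 1 and y, and the
   determinant can be 1 or -1 only for x together with one of the pairs {1, y},
   {1, y^2}, {1, m_2}, {m_2, y^2}. At xi = 1 the last three have determinants
   6, 2 and 12 up to sign. *)

(** * Linear algebra: bases and change of basis *)

(** Coefficients of repeated entries add up, so one duplicate-free list [S] can serve several
    combinations at once. *)
Lemma lin_span_seq (R : nzRingType) (V : lmodType R) (S : seq V) (s : seq V) (c : V -> R) :
  uniq S -> {subset s <= S} ->
  exists d : V -> R, \sum_(x <- s) c x *: x = \sum_(x <- S) d x *: x.
Proof.
move=> uS; elim: s => [|y s IHs] sS.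
  by exists (fun=> 0); rewrite big_nil big1 // => x _; rewrite scale0r.
have [z zs|d dE] := IHs; first by apply: sS; rewrite inE zs orbT.
exists (fun x => (if x == y then c y else 0) + d x).
rewrite big_cons dE; under [RHS]eq_bigr do rewrite scalerDl.
rewrite big_split /=; congr (_ + _).
rewrite (bigD1_seq y) ?sS ?mem_head //= eqxx big1 ?addr0 // => x /negPf ->.
by rewrite scale0r.
Qed.

Lemma sum_delta (R : nzRingType) (V : lmodType R) (I : finType) (e : I -> V) (i : I) :
  \sum_k (i == k)%:R *: e k = e i.
Proof.
rewrite (bigD1 i) //= eqxx scale1r big1 ?addr0 // => k /negPf ki.
by rewrite eq_sym ki scale0r.
Qed.

(** Freeness gives injectivity: if [e i = e j] with i and j distinct, the difference of two unit
    vectors would be a nontrivial relation. *)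
Lemma free_is_basis (R : nzRingType) (V : lmodType R) (I : finType) (e : I -> V)
    (M : set V) :
  (forall c, \sum_i c i *: e i = 0 -> forall i, c i = 0) ->
  (forall i, M (e i)) ->
  (forall v, M v -> exists c, v = \sum_i c i *: e i) ->
  is_basis (range e) M.
Proof.
move=> efree eM espan.
have einj : injective e.
  move=> i j eij; apply/eqP/negPn/negP => /negPf ij.
  have := efree (fun k => (i == k)%:R - (j == k)%:R).
  under eq_bigr do rewrite scalerBl.
  rewrite sumrB !sum_delta eij subrr => /(_ erefl i).
  by rewrite eqxx eq_sym ij subr0 => /eqP; rewrite oner_eq0.
split=> [_ [i _ <-] //|s c us sB s0|v /espan[c ->]].
  move=> x xs; have [i _ ix] := sB x xs; move: xs; rewrite -ix => xs.
  have <- : \sum_(y <- s) c y * (e i == y)%:R = c (e i).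
    rewrite (bigD1_seq (e i)) //= eqxx mulr1 big1 ?addr0 // => y.
    by rewrite eq_sym => /negPf ->; rewrite mulr0.
  apply: (efree (fun i => \sum_(x <- s) c x * (e i == x)%:R)).
  under eq_bigr do rewrite scaler_suml.
  rewrite exchange_big /= -[RHS]s0; apply: eq_big_seq => _ /sB[j _ <-].
  rewrite -[X in _ = _ *: X](sum_delta _ _ _ e j) scaler_sumr; apply: eq_bigr => k _.
  by rewrite scalerA (inj_eq einj) (eq_sym k).
exists [seq e i | i <- enum I].
exists (fun v => \sum_i (e i == v)%:R * c i); split=> [_ /mapP[i _ ->]|]; first by exists i.
rewrite big_map big_enum /=; apply: eq_bigr => i _; congr (_ *: _).
rewrite (bigD1 i) //= eqxx mul1r big1 ?addr0 // => k ki.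
by rewrite (inj_eq einj) (negPf ki) mul0r.
Qed.

(** The expansions of the finitely many [e i] involve a finite part [s] of [B], which already spans
    [M]; independence then leaves no room in [B] outside [s]. The two coordinate matrices are
    mutually inverse, hence square. *)
Lemma basis_change (R : comUnitRingType) (V : lmodType R) (n : nat) (e : 'I_n -> V)
    (B M : set V) :
  (forall c, \sum_i c i *: e i = 0 -> forall i, c i = 0) ->
  (forall i, M (e i)) ->
  (forall v, M v -> exists c, v = \sum_i c i *: e i) ->
  is_basis B M ->
  exists (z : 'I_n -> V) (P : 'M[R]_n),
    [/\ B = range z, P \in unitmx & forall j, z j = \sum_i P j i *: e i].
Proof.
move=> efree eM espan [BM Bfree Bspan].
have /choice [f fE] : forall i, exists sc : seq V * (V -> R),
    (forall x, x \in sc.1 -> B x) /\ e i = \sum_(x <- sc.1) sc.2 x *: x.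
  by move=> i; have [s [c h]] := Bspan _ (eM i); exists (s, c).
pose s := undup (flatten [seq (f i).1 | i : 'I_n]).
have us : uniq s by exact: undup_uniq.
have sB x : x \in s -> B x.
  rewrite mem_undup => /flatten_mapP[i _]; exact: (fE i).1.
have /choice [q qE] : forall i, exists d : V -> R, e i = \sum_(x <- s) d x *: x.
  move=> i; have [x xs|d dE] := @lin_span_seq _ _ s (f i).1 (f i).2 us.
    by rewrite mem_undup; apply/flatten_mapP; exists i; rewrite ?mem_enum.
  by exists d; rewrite -dE; exact: (fE i).2.
have Bs v : B v -> v \in s.
  move=> Bv; apply/negPn/negP => vs.
  have [c vE] := espan v (BM v Bv).
  (* Expanding [v] over [e], and each [e i] over [s], yields a relation on [v :: s] whose
     coefficient at [v] is -1. *)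
  pose d x := if x == v then -1 else \sum_i c i * q i x.
  have := Bfree (v :: s) d; rewrite cons_uniq vs us => /(_ isT) H.
  have : d v = 0.
    apply: H (mem_head _ _) => [x|].
      by rewrite inE => /orP[/eqP->|/sB].
    rewrite big_cons {1}/d eqxx scaleN1r.
    have -> : \sum_(x <- s) d x *: x = v.
      rewrite [RHS]vE; under [RHS]eq_bigr do rewrite qE scaler_sumr.
      rewrite exchange_big /=; apply: eq_big_seq => x xs.
      rewrite /d; case: eqP => [xv|_]; first by rewrite -xv xs in vs.
      by rewrite scaler_suml; apply: eq_bigr => i _; rewrite scalerA.
    by rewrite addNr.
  by rewrite /d eqxx => /eqP; rewrite oppr_eq0 oner_eq0.
pose z := tnth (in_tuple s).
have zs j : z j \in s by rewrite -[s]/(val (in_tuple s)) mem_tnth.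
have zinj : injective z by apply/tuple_uniqP.
have sumz (c : V -> R) : \sum_(x <- s) c x *: x = \sum_j c (z j) *: z j.
  by rewrite big_tnth.
have Bz : B = range z.
  apply/seteqP; split=> [v /Bs vs|_ [j _ <-]]; last exact/sB.
  by have /tnthP[j ->] : v \in in_tuple s := vs; exists j.
have {Bs zs} zfree (c : 'I_(size s) -> R) : \sum_j c j *: z j = 0 -> forall j, c j = 0.
  move=> c0 j; pose d x := if [pick k | z k == x] is Some k then c k else 0.
  have dE k : d (z k) = c k.
    by rewrite /d; case: pickP => [l /eqP/zinj -> //|/(_ k)]; rewrite eqxx.
  rewrite -dE; apply: Bfree us sB _ _ (zs j).
  by rewrite sumz; under eq_bigr do rewrite dE.
have /choice [p pE] : forall j, exists c, z j = \sum_i c i *: e i.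
  by move=> j; apply/espan/BM; rewrite Bz; exists j.
have {}qE i : e i = \sum_j q i (z j) *: z j by rewrite -sumz -qE.
clear Bfree sumz zinj sB us Bspan BM; move: (size s) z Bz zfree p pE qE => m z Bz zfree p pE qE.
pose P := \matrix_(j < m, i < n) p j i.
pose Q := \matrix_(i < n, j < m) q i (z j).
(* Expanding [u] over [v] and back must return the original coefficients, since [u] is free; this is
   applied once in each direction. *)
have comb_free (I J : finType) (u : I -> V) (v : J -> V) (a : I -> J -> R) (b : J -> I -> R) :
    (forall c, \sum_i c i *: u i = 0 -> forall i, c i = 0) ->
    (forall i, u i = \sum_j a i j *: v j) -> (forall j, v j = \sum_i b j i *: u i) ->
    forall i k, \sum_j a i j * b j k = (i == k)%:R.
  move=> ufree uE vE i k; apply/eqP; rewrite -subr_eq0; apply/eqP.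
  apply: (ufree (fun k => \sum_j a i j * b j k - (i == k)%:R)) k.
  under eq_bigr do rewrite scalerBl scaler_suml.
  rewrite sumrB sum_delta uE exchange_big /= -sumrB big1 // => j _.
  rewrite vE scaler_sumr -sumrB big1 // => k _.
  by rewrite scalerA subrr.
have QP : Q *m P = 1%:M.
  apply/matrixP => i k; rewrite !mxE -(comb_free _ _ _ _ _ _ efree qE pE i k).
  by apply: eq_bigr => j _; rewrite !mxE.
have PQ : P *m Q = 1%:M.
  apply/matrixP => i k; rewrite !mxE -(comb_free _ _ _ _ _ _ zfree pE qE i k).
  by apply: eq_bigr => j _; rewrite !mxE.
(* Each one-sided inverse bounds one size by the other. *)
have mn : m = n by apply/eqP; rewrite eqn_leq (mulmx1_min PQ) (mulmx1_min QP).
subst m; exists z, P; split=> // [|j]; first by case: (mulmx1_unit PQ).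
by rewrite pE; apply: eq_bigr => i _; rewrite mxE.
Qed.

(** Expansion of a 3 by 3 determinant along its first row, kept as a plain polynomial expression so
    that [ring] and evaluation in xi apply directly. *)
Definition det_coords {R : comNzRingType} (a b c a' b' c' a'' b'' c'' : R) : R :=
  a * (b' * c'' - c' * b'') - b * (a' * c'' - c' * a'') + c * (a' * b'' - b' * a'').

Lemma det3 (R : comNzRingType) (P : 'M[R]_3) :
  let o0 := inord 0 in let o1 := inord 1 in let o2 := inord 2 in
  \det P = det_coords (P o0 o0) (P o0 o1) (P o0 o2) (P o1 o0) (P o1 o1) (P o1 o2)
                      (P o2 o0) (P o2 o1) (P o2 o2).
Proof.
move=> o0 o1 o2.
pose F k l := P (inord k) (inord l).
have PE i j : P i j = F i j by rewrite /F !inord_val.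
rewrite (expand_det_row _ ord0) !big_ord_recl big_ord0 /cofactor.
rewrite !(expand_det_row _ ord0) !big_ord_recl !big_ord0 /cofactor !det_mx11 !mxE.
by rewrite !PE /= !inordK // /bump /= /det_coords; ring.
Qed.

(** * Coordinates in the Hecke algebra and in its centre *)

Lemma sum_S3 (V : nmodType) (F : 'S_3 -> V) : \sum_w F w = \sum_(w <- S3_elts) F w.
Proof.
apply: perm_big; apply: uniq_perm; rewrite ?S3_elts_uniq ?index_enum_uniq // => w.
by rewrite mem_index_enum S3_eltsP.
Qed.

Section Hecke3Coordinates.
Context {H : algType {poly int}} {T : 'S_3 -> H} (hH : hecke3 T).
Local Notation R := {poly int}.
Local Notation A := (T s1).
Local Notation B := (T s2).

Definition hcomb (a b c d e f : R) : H :=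
  a%:A + b *: A + c *: B + d *: T (s1 * s2)%g + e *: T (s2 * s1)%g
  + f *: T (s1 * s2 * s1)%g.

Lemma T_1 : T 1%g = 1.
Proof.
have [l0 _ _ _ _ _] := coxlen_S3.
by have := @hecke3_reduced _ _ hH [::]; rewrite !big_nil l0 => /(_ isT erefl).
Qed.

Lemma hcombE (c : 'S_3 -> R) : \sum_w c w *: T w =
  hcomb (c 1%g) (c s1) (c s2) (c (s1 * s2)%g) (c (s2 * s1)%g) (c (s1 * s2 * s1)%g).
Proof. by rewrite sum_S3 !big_cons big_nil addr0 T_1 /hcomb !addrA. Qed.

Lemma hcomb_ind (P : H -> Prop) :
  (forall a b c d e f, P (hcomb a b c d e f)) -> forall v, P v.
Proof.
move=> hP v; suff [c ->] : exists c, v = \sum_w c w *: T w by rewrite hcombE.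
have [_ _ /(_ v I)[s [c [sT ->]]]] := hecke3_basis hH.
have S w : T w \in map T S3_elts by rewrite map_f ?S3_eltsP.
have us : uniq (map T S3_elts) by rewrite map_inj_uniq ?S3_elts_uniq //; exact: (hecke3_inj hH).
have [_ /sT[w _ <-]//|d ->] := lin_span_seq _ _ (map T S3_elts) s c us.
by exists (d \o T); rewrite big_map sum_S3.
Qed.

Lemma hcombD a b c d e f a' b' c' d' e' f' :
  hcomb a b c d e f + hcomb a' b' c' d' e' f' =
  hcomb (a + a') (b + b') (c + c') (d + d') (e + e') (f + f').
Proof.
rewrite /hcomb !scalerDl !addrA.
by rewrite [LHS](ACl (1*7*2*8*3*9*4*10*5*11*6*12)%AC).
Qed.

Lemma hcombZ k a b c d e f :
  k *: hcomb a b c d e f =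
  hcomb (k * a) (k * b) (k * c) (k * d) (k * e) (k * f).
Proof. by rewrite /hcomb !scalerDr !scalerA. Qed.

Lemma hcomb_eq0 a b c d e f : hcomb a b c d e f = 0 ->
  [/\ a = 0, b = 0 & c = 0] /\ [/\ d = 0, e = 0 & f = 0].
Proof.
move=> E.
have us : uniq (map T S3_elts) by rewrite map_inj_uniq ?S3_elts_uniq //; exact: (hecke3_inj hH).
have [_ free _] := hecke3_basis hH.
pose s := [:: a; b; c; d; e; f].
(* [lin_indep] takes coefficients indexed by vectors, so the six scalars are attached to the basis
   vectors by position. *)
pose G (v : H) := nth 0 s (index v (map T S3_elts)).
have Gs (i : nat) : (i < 6)%N -> G (nth 0 (map T S3_elts) i) = nth 0 s i.
  by move=> i6; rewrite /G index_uniq.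
have g0 := Gs 0%N isT; have g1 := Gs 1%N isT; have g2 := Gs 2%N isT.
have g3 := Gs 3%N isT; have g4 := Gs 4%N isT; have g5 := Gs 5%N isT.
have G0 w : G (T w) = 0.
  apply: free us _ _ _ (map_f _ (S3_eltsP w)) => [v /mapP[u _ ->]|]; first by exists u.
  rewrite /S3_elts !big_cons big_nil addr0; move: g0 g1 g2 g3 g4 g5; rewrite /=.
  by do 6![move->]; rewrite T_1 !addrA.
by move: g0 g1 g2 g3 g4 g5; rewrite /= !G0; do 6![move<-].
Qed.

Lemma hcomb_inj a b c d e f a' b' c' d' e' f' :
  hcomb a b c d e f = hcomb a' b' c' d' e' f' ->
  [/\ a = a', b = b' & c = c'] /\ [/\ d = d', e = e' & f = f'].
Proof.
move/eqP; rewrite -subr_eq0 -scaleN1r hcombZ hcombD !mulN1r => /eqP/hcomb_eq0.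
by do 2![case]; do 3![move/subr0_eq->]; case; do 3![move/subr0_eq->].
Qed.

Lemma T_mulr_s1 : [/\ A * A = 1 + 'X *: A, B * A = T (s2 * s1)%g,
  T (s1 * s2)%g * A = T (s1 * s2 * s1)%g,
  T (s2 * s1)%g * A = B + 'X *: T (s2 * s1)%g
  & T (s1 * s2 * s1)%g * A = T (s1 * s2)%g + 'X *: T (s1 * s2 * s1)%g].
Proof.
have [l0 l1 l2 l3 l4 l5] := coxlen_S3.
have s1s : s1 \in [:: s1; s2] by rewrite inE eqxx.
by split; rewrite (hecke3_mul hH) // -?mulgA ?s1K ?mulg1 ?mulgA
  ?l0 ?l1 ?l2 ?l3 ?l4 ?l5 //= T_1.
Qed.

Lemma T_mulr_s2 : [/\ B * B = 1 + 'X *: B, A * B = T (s1 * s2)%g,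
  T (s2 * s1)%g * B = T (s1 * s2 * s1)%g,
  T (s1 * s2)%g * B = A + 'X *: T (s1 * s2)%g
  & T (s1 * s2 * s1)%g * B = T (s2 * s1)%g + 'X *: T (s1 * s2 * s1)%g].
Proof.
have [l0 l1 l2 l3 l4 l5] := coxlen_S3.
have s2s : s2 \in [:: s1; s2] by rewrite !inE eqxx orbT.
(* The braid relation, read backwards, exposes a final [s2] in the longest element, which can then
   cancel. *)
split; rewrite (hecke3_mul hH) // -?s121 -?mulgA ?s2K ?mulg1 ?mulgA ?s121
  ?l0 ?l1 ?l2 ?l3 ?l4 ?l5 //= T_1 //.
Qed.

Lemma hcombM1 a b c d e f : hcomb a b c d e f * A =
  hcomb b (a + 'X * b) e f (c + 'X * e) (d + 'X * f).
Proof.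
have [t1 t2 t3 t4 t5] := T_mulr_s1.
rewrite /hcomb !mulrDl -!scalerAl mul1r t1 t2 t3 t4 t5.
rewrite !scalerDl !scalerDr !scalerA !(mulrC _ 'X) !addrA.
by rewrite [LHS](ACl (2*1*3*6*8*4*7*5*9)%AC).
Qed.

Lemma hcombM2 a b c d e f : hcomb a b c d e f * B =
  hcomb c d (a + 'X * c) (b + 'X * d) f (e + 'X * f).
Proof.
have [t1 t2 t3 t4 t5] := T_mulr_s2.
rewrite /hcomb !mulrDl -!scalerAl mul1r t1 t2 t3 t4 t5.
rewrite !scalerDl !scalerDr !scalerA !(mulrC _ 'X) !addrA.
by rewrite [LHS](ACl (3*5*1*4*2*6*8*7*9)%AC).
Qed.

(** Each [T w] factors along a reduced word, so together with [hcombM1] and [hcombM2] every product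
    reduces to polynomial identities in the coordinates. *)
Lemma hcombMr u a b c d e f : u * hcomb a b c d e f =
  a *: u + b *: (u * A) + c *: (u * B) + d *: (u * A * B) + e *: (u * B * A)
  + f *: (u * A * B * A).
Proof.
have [_ tBA tABA _ _] := T_mulr_s1; have [_ tAB _ _ _] := T_mulr_s2.
by rewrite /hcomb -tABA -tBA -tAB !mulrDr -!scalerAr mulr1 !mulrA.
Qed.

Definition hcomb_simp := (hcombMr, hcombM1, hcombM2, hcombZ, hcombD).

(* The coordinates of a + b (L2 + L3) + c L2 L3. *)
Definition zcomb (a b c : R) : H := hcomb a b b c c (b + 'X * c).

Lemma zcombD a b c a' b' c' :
  zcomb a b c + zcomb a' b' c' = zcomb (a + a') (b + b') (c + c').
Proof. by rewrite /zcomb hcombD; congr hcomb; ring. Qed.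

Lemma zcombZ k a b c : k *: zcomb a b c = zcomb (k * a) (k * b) (k * c).
Proof. by rewrite /zcomb hcombZ; congr hcomb; ring. Qed.

Lemma zcombM a b c a' b' c' : zcomb a b c * zcomb a' b' c' = zcomb
  (a * a' + 3 * (b * b') + 'X * (b * c' + c * b') + (2 + 'X^2) * (c * c'))
  (a * b' + b * a' + 2 * 'X * (b * b') + (2 + 'X^2) * (b * c' + c * b')
    + (3 * 'X + 'X^3) * (c * c'))
  (a * c' + c * a' + (3 + 'X^2) * (b * b') + (4 * 'X + 'X^3) * (b * c' + c * b')
    + (1 + 4 * 'X^2 + 'X^4) * (c * c')).
Proof. by rewrite /zcomb !hcomb_simp; congr hcomb; ring. Qed.

Lemma zcomb_inj a b c a' b' c' :
  zcomb a b c = zcomb a' b' c' -> [/\ a = a', b = b' & c = c'].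
Proof. by case/hcomb_inj => -[-> -> _] [-> _ _]. Qed.

Lemma zcomb_center a b c : ring_center H (zcomb a b c).
Proof.
elim/hcomb_ind => a' b' c' d' e' f'.
by rewrite /zcomb !hcomb_simp; congr hcomb; ring.
Qed.

(** Commuting with [T s2] gives f = b + xi e; commuting with [T s1] gives e = d and f = c + xi d.
    Hence b = c, and three free parameters remain. *)
Lemma centerP v : ring_center H v -> exists a b c, v = zcomb a b c.
Proof.
elim/hcomb_ind: v => a b c d e f zv.
have AE : A = hcomb 0 1 0 0 0 0 by rewrite /hcomb !scale0r !scale1r add0r !addr0.
have BE : B = hcomb 0 0 1 0 0 0 by rewrite /hcomb !scale0r !scale1r !add0r !addr0.
have := zv A; have := zv B; rewrite {2}AE {2}BE !hcomb_simp.
move=> /hcomb_inj [_ [_ fE _]] /hcomb_inj [[_ _ eE] [fE' _ _]].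
move: fE eE fE'; rewrite !(mul0r, mulr0, mul1r, mulr1, addr0, add0r) => -> ->.
rewrite (mulrC d) => /addIr bc.
by exists a, b, d; rewrite /zcomb -bc (mulrC 'X).
Qed.
End Hecke3Coordinates.

(** * Monomial symmetric polynomials in the Jucys--Murphy elements *)

Definition mnm3 (i j k : nat) : 'X_{1..3} := [multinom nth 0%N [:: i; j; k] o | o < 3].

Lemma mnm3_inj i j k i' j' k' :
  (mnm3 i j k == mnm3 i' j' k') = [&& i == i', j == j' & k == k'].
Proof.
apply/eqP/and3P => [E|[/eqP-> /eqP-> /eqP->]//].
have h (o : 'I_3) : mnm3 i j k o = mnm3 i' j' k' o by rewrite E.
by have := (h (inord 0), h (inord 1), h (inord 2));
  rewrite !mnmE !inordK //= => -[[-> ->] ->].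
Qed.

(** With explicit exponent triples, the duplicates removed in [monsym] are decided by comparing the
    parts of [lam]. *)
Lemma monom_of_S3 lam : map (monom_of lam) S3_elts =
  let l i := nth 0%N lam i in
  [:: mnm3 (l 0) (l 1) (l 2); mnm3 (l 1) (l 0) (l 2); mnm3 (l 0) (l 2) (l 1);
      mnm3 (l 1) (l 2) (l 0); mnm3 (l 2) (l 0) (l 1); mnm3 (l 2) (l 1) (l 0)]%N.
Proof.
pose o0 : 'I_3 := inord 0; pose o1 : 'I_3 := inord 1; pose o2 : 'I_3 := inord 2.
have o01 : (o0 == o1) = false by rewrite -val_eqE /= !inordK.
have o02 : (o0 == o2) = false by rewrite -val_eqE /= !inordK.
have o12 : (o1 == o2) = false by rewrite -val_eqE /= !inordK.
have oE := (o01, o02, o12, eq_sym o1 o0, eq_sym o2 o0, eq_sym o2 o1, eqxx).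
have sE : ((s1 o0 = o1) * (s1 o1 = o0) * (s1 o2 = o2) *
           (s2 o0 = o0) * (s2 o1 = o2) * (s2 o2 = o1))%type.
  by rewrite /s1 /s2 !permE /= -/o0 -/o1 -/o2 !oE.
have sV : (((s1^-1)%g = s1) * ((s2^-1)%g = s2))%type by rewrite /s1 /s2 !tpermV.
have mE (w : 'S_3) i j k : (w^-1)%g o0 = i -> (w^-1)%g o1 = j -> (w^-1)%g o2 = k ->
    monom_of lam w = mnm3 (nth 0%N lam i) (nth 0%N lam j) (nth 0%N lam k).
  move=> <- <- <-; apply/mnmP => o; rewrite !mnmE.
  by case: (ord3P o) => ->; rewrite !inordK.
rewrite /S3_elts /=.
by congr [:: _; _; _; _; _; _]; rewrite (mE _ _ _ _ erefl erefl erefl);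
  rewrite ?invMg ?invg1 ?sV ?permM ?perm1 ?sE !inordK.
Qed.

Section Mxi.
Set Implicit Arguments.
Unset Strict Implicit.
Context {H : algType {poly int}} {T : 'S_3 -> H} (hH : hecke3 T).
Local Notation R := {poly int}.
Local Notation L2 := (T s1).
Local Notation L3 := (T (s1 * s2 * s1)%g + T s2).

Lemma mJM_sum lam : mJM T lam =
  \sum_(m <- undup (map (monom_of lam) S3_elts))
    0 ^+ m (inord 0) * L2 ^+ m (inord 1) * L3 ^+ m (inord 2).
Proof.
rewrite /mJM /monsym (perm_big (undup (map (monom_of lam) S3_elts))); last first.
  apply: perm_undup => m; rewrite ?mem_codom; apply/mapP/mapP => -[w _ ->]; exists w => //.
    exact: S3_eltsP.
  by rewrite mem_enum.
rewrite raddf_sum; apply: eq_bigr => m _ /=.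
rewrite mmapX /mmap1 !big_ord_recl big_ord0 mulr1 mulrA /JM /=.
by congr (0 ^+ m _ * L2 ^+ m _ * L3 ^+ m _); apply: val_inj; rewrite /= inordK.
Qed.

Lemma mnm3E i j k : 0 ^+ mnm3 i j k (inord 0) * L2 ^+ mnm3 i j k (inord 1) *
  L3 ^+ mnm3 i j k (inord 2) = 0 ^+ i * L2 ^+ j * L3 ^+ k.
Proof. by rewrite !mnmE !inordK. Qed.

Lemma mJM_nil : mJM T [::] = 1.
Proof.
rewrite mJM_sum monom_of_S3 /= !inE !eqxx /= big_seq1 mnm3E !expr0 !mulr1 //.
Qed.

(** Here and in the next two lemmas, L1 = 0 leaves only the monomials free of the first variable;
    with three parts there are none. *)
Lemma mJM_1 k : (0 < k)%N -> mJM T [:: k] = L2 ^+ k + L3 ^+ k.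
Proof.
move=> k0; have [kE kE'] : (k == 0)%N = false /\ (0 == k)%N = false by split; lia.
rewrite mJM_sum monom_of_S3 /= !inE !mnm3_inj !eqxx kE kE' /=.
rewrite !big_cons big_nil !mnm3E !expr0 !expr0n kE.
by rewrite /= !(mul0r, mul1r, mulr1, addr0, add0r).
Qed.

Lemma mJM_2 a b : (0 < a)%N -> (0 < b)%N -> mJM T [:: a; b] =
  if a == b then L2 ^+ a * L3 ^+ a else L2 ^+ a * L3 ^+ b + L2 ^+ b * L3 ^+ a.
Proof.
move=> a0 b0.
have [aE aE'] : (a == 0)%N = false /\ (0 == a)%N = false by split; lia.
have [bE bE'] : (b == 0)%N = false /\ (0 == b)%N = false by split; lia.
rewrite mJM_sum monom_of_S3 /= !inE !mnm3_inj !eqxx aE aE' bE bE' (eq_sym b a).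
case: eqP => [->|ab] /=; rewrite !big_cons big_nil !mnm3E !expr0 !expr0n ?aE bE.
  by rewrite /= !(mul0r, mul1r, mulr1, addr0, add0r).
by rewrite /= !(mul0r, mul1r, mulr1, addr0, add0r) 1?addrC.
Qed.

Lemma mJM_3 a b c : (0 < a)%N -> (0 < b)%N -> (0 < c)%N -> mJM T [:: a; b; c] = 0.
Proof.
move=> a0 b0 c0; rewrite mJM_sum big1_seq // => m /andP[_].
rewrite mem_undup monom_of_S3 /= !inE => H0.
have {H0} : exists i j k, m = mnm3 i j k /\ (0 < i)%N.
  by move: H0; do ![case/orP]; move/eqP->; do 3!eexists; split; try reflexivity.
by move=> [i [j [k [-> i0]]]]; rewrite mnm3E expr0n eqn0Ngt i0 !mul0r.
Qed.

Local Notation hcomb := (@hcomb H T).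
Local Notation zcomb := (@zcomb H T).

Lemma L2E : L2 = hcomb 0 1 0 0 0 0.
Proof. by rewrite /hcomb !scale0r !scale1r add0r !addr0. Qed.

Lemma L3E : L3 = hcomb 0 0 1 0 0 1.
Proof. by rewrite /hcomb !scale0r !scale1r !add0r !addr0 addrC. Qed.

Lemma zcomb1 : 1 = zcomb 1 0 0.
Proof. by rewrite /zcomb /hcomb mulr0 addr0 !scale0r scale1r !addr0. Qed.

Lemma L2D3 : L2 + L3 = zcomb 0 1 0.
Proof. by rewrite L2E L3E hcombD /zcomb; congr hcomb; ring. Qed.

Lemma L2M3 : L2 * L3 = zcomb 0 0 1.
Proof. by rewrite L2E L3E !(hcomb_simp hH) /zcomb; congr hcomb; ring. Qed.

Lemma L3M2 : L3 * L2 = zcomb 0 0 1.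
Proof. by rewrite L2E L3E !(hcomb_simp hH) /zcomb; congr hcomb; ring. Qed.

Lemma comm_L23 : GRing.comm L2 L3.
Proof. by rewrite /GRing.comm L2M3 L3M2. Qed.

(** Newton's recurrence: L2 and L3 commute and are the roots of t^2 - x t + y with x = L2 + L3 and y
    = L2 L3. *)
Lemma power_sum_rec k : L2 ^+ k.+2 + L3 ^+ k.+2 =
  zcomb 0 1 0 * (L2 ^+ k.+1 + L3 ^+ k.+1) - zcomb 0 0 1 * (L2 ^+ k + L3 ^+ k).
Proof.
have -> : zcomb 0 0 1 * (L2 ^+ k + L3 ^+ k) = L3 * L2 ^+ k.+1 + L2 * L3 ^+ k.+1.
  by rewrite mulrDr -{1}L3M2 -L2M3 !exprS !mulrA.
rewrite -L2D3 mulrDl !mulrDr opprD !addrA !(exprS _ k.+1).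
by rewrite [RHS](ACl (1*4*(2*6)*(3*5))%AC) /= !subrr !addr0.
Qed.

(** * Central characters at xi = 0 and classification of [Mxi] *)

(* At xi = 0 the triple (t, s, d) lists the values of the central characters of
   the trivial, sign and 2-dimensional representations. *)
Definition zchar (z : H) (t s d : int) : Prop := exists a b c : R,
  [/\ z = zcomb a b c, t = a.[0] + 3 * b.[0] + 2 * c.[0],
      s = a.[0] - 3 * b.[0] + 2 * c.[0] & d = a.[0] - c.[0]].

(** Central characters are ring morphisms; here this is checked by evaluating the structure
    constants of [zcombM] at 0. *)
Lemma zcharM z z' t t' s s' d d' :
  zchar z t s d -> zchar z' t' s' d' -> zchar (z * z') (t * t') (s * s') (d * d').
Proof.
move=> [a [b [c [-> -> -> ->]]]] [a' [b' [c' [-> -> -> ->]]]].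
rewrite (zcombM hH); do 3!eexists.
split; first reflexivity.
all: rewrite !(hornerD, hornerM, hornerX, hornerXn, hornerMn, hornerC, expr0n) /=; ring.
Qed.

Lemma zcharB z z' t t' s s' d d' :
  zchar z t s d -> zchar z' t' s' d' -> zchar (z - z') (t - t') (s - s') (d - d').
Proof.
move=> [a [b [c [-> -> -> ->]]]] [a' [b' [c' [-> -> -> ->]]]].
rewrite -scaleN1r zcombZ zcombD; do 3!eexists; split; first reflexivity; rewrite !hornerE /=; ring.
Qed.

Lemma zcharP a b c t s d : zchar (zcomb a b c) t s d ->
  [/\ t = a.[0] + 3 * b.[0] + 2 * c.[0],
      s = a.[0] - 3 * b.[0] + 2 * c.[0] & d = a.[0] - c.[0]].
Proof. by move=> [a' [b' [c' [/(zcomb_inj hH)[<- <- <-]]]]]. Qed.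

Lemma zchar1 : zchar 1 1 1 1.
Proof. by exists 1, 0, 0; rewrite -zcomb1 !hornerE. Qed.

Lemma zchar_L2M3X n : zchar (zcomb 0 0 1 ^+ n) (2 ^+ n) (2 ^+ n) ((-1) ^+ n).
Proof.
elim: n => [|n IHn]; first by rewrite !expr0; exact: zchar1.
rewrite !exprS; apply: zcharM IHn.
by exists 0, 0, 1; rewrite !hornerE.
Qed.

(** In the trivial, sign and 2-dimensional representations the joint eigenvalues of L2, L3 are (1,
    2), then (-1, -2), then (1, -1) and (-1, 1). The proof carries two consecutive exponents through
    the recurrence. *)
Lemma zchar_power_sum k : zchar (L2 ^+ k + L3 ^+ k)
  (1 + 2 ^+ k) ((-1) ^+ k * (1 + 2 ^+ k)) (1 + (-1) ^+ k).
Proof.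
suff [] : zchar (L2 ^+ k + L3 ^+ k)
    (1 + 2 ^+ k) ((-1) ^+ k * (1 + 2 ^+ k)) (1 + (-1) ^+ k) /\
  zchar (L2 ^+ k.+1 + L3 ^+ k.+1)
    (1 + 2 ^+ k.+1) ((-1) ^+ k.+1 * (1 + 2 ^+ k.+1)) (1 + (-1) ^+ k.+1) by [].
have cx : zchar (zcomb 0 1 0) 3 (-3) 0 by exists 0, 1, 0; rewrite !hornerE.
have cy : zchar (zcomb 0 0 1) 2 2 (-1) by exists 0, 0, 1; rewrite !hornerE.
elim: k => [|k [IH0 IH1]]; split=> //.
- by exists 2, 0, 0; rewrite !expr0 !hornerE zcomb1 zcombD addr0.
- by rewrite !expr1 L2D3.
rewrite power_sum_rec.
have := zcharB (zcharM cx IH1) (zcharM cy IH0).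
by congr zchar; rewrite !exprS; ring.
Qed.

(** For large exponents only divisibility by 8 and positivity matter, so a power of 2 can be handed
    to [lia] as 8 times a variable. *)
Lemma pow2_cases n : [\/ n = 0%N, n = 1%N, n = 2%N |
  exists2 m : int, 1 <= m & (2 : int) ^+ n = 8 * m].
Proof.
case: n => [|[|[|n]]]; [exact: Or41|exact: Or42|exact: Or43|apply: Or44].
exists (2 ^+ n); last by rewrite !exprS; ring.
by rewrite exprn_ege1.
Qed.

(* Elements of [Mxi] on which the trivial and sign characters agree at xi = 0. The
   first case gathers those whose characters vanish modulo 2: they cannot belong to
   a pair with determinant t d' - t' d equal to 3 or -3. *)
Definition even_kind (z : H) (t d : int) : Prop :=
  [\/ exists t' d', t = 2 * t' /\ d = 2 * d',
      [/\ z = 1, t = 1 & d = 1],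
      exists n, [/\ z = L2 ^+ n + L3 ^+ n, t = 1 + 2 ^+ n, d = 2, (1 < n)%N & ~~ odd n] |
      exists n, [/\ z = zcomb 0 0 1 ^+ n, t = 2 ^+ n, d = (-1) ^+ n & (0 < n)%N]].

(** The parity of the weight of lambda decides the alternative, except that partitions with three
    parts give 0 and go to the second. In the first, t is three times the coordinate along x at xi =
    0, so t > 3 or t even prevents that coordinate from being a unit. *)
Lemma Mxi_cases z : Mxi T z ->
  (exists2 t, zchar z t (-t) 0 & (z = zcomb 0 1 0 \/ (3 < t) \/ exists t', t = 2 * t')) \/
  (exists t d, zchar z t t d /\ even_kind z t d).
Proof.
have psum n : (0 < n)%N ->
  (exists2 t, zchar (L2 ^+ n + L3 ^+ n) t (-t) 0 &
     (t = 1 + 2 ^+ n /\ (L2 ^+ n + L3 ^+ n = zcomb 0 1 0 \/ (3 < t)))) \/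
  ([/\ zchar (L2 ^+ n + L3 ^+ n) (1 + 2 ^+ n) (1 + 2 ^+ n) 2, (1 < n)%N & ~~ odd n]).
  move=> n0; have := zchar_power_sum n; rewrite -signr_odd; case: (boolP (odd n)) => no.
    rewrite expr1 mulN1r subrr => zn; left; exists (1 + 2 ^+ n) => //; split=> //.
    have [n0'|n1|n2|[m m1 ->]] := pow2_cases n.
    - by rewrite n0' in n0.
    - by left; rewrite n1 !expr1 L2D3.
    - by rewrite n2 in no.
    - by right; lia.
  rewrite expr0 mul1r => zn; right; split=> //.
  by case: n n0 no {zn} => [|[|]].
case=> lam /= /andP[/andP[_ pos] sz] <-{z}.
case: lam pos sz => [|a [|b [|c [|]]]] //=.
- by move=> _ _; right; rewrite mJM_nil //; exists 1, 1; split; [exact: zchar1|apply: Or42].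
- rewrite andbT => a0 _; rewrite mJM_1 //.
  have [[t zt [_ h]]|[zn n1 no]] := psum a a0.
    by left; exists t => //; case: h => h; [left|right; left].
  by right; do 2!eexists; split; [exact: zn|apply: Or43; exists a].
- rewrite andbT => /andP[a0 b0] _; rewrite mJM_2 //.
  wlog ba : a b a0 b0 / (b <= a)%N => [th|].
    have [|/ltnW ab] := leqP b a; first exact: th.
    have := th b a b0 a0 ab; rewrite eq_sym; case: eqP => [->//|_].
    by rewrite addrC.
  case: eqP => [->|/eqP ab].
    right; exists (2 ^+ b), ((-1) ^+ b).
    rewrite -(exprMn_comm _ comm_L23) L2M3; split; first exact: zchar_L2M3X.
    by apply: Or44; exists b.
  (* For b < a the factor (L2 L3)^b splits off and leaves a power sum, so the characters are
     products of known ones. *)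
  have -> : L2 ^+ a * L3 ^+ b + L2 ^+ b * L3 ^+ a =
      zcomb 0 0 1 ^+ b * (L2 ^+ (a - b) + L3 ^+ (a - b)).
    have cX i j : L2 ^+ i * L3 ^+ j = L3 ^+ j * L2 ^+ i.
      by apply/commrX/commr_sym/commrX/commr_sym; exact: comm_L23.
    rewrite -L2M3 (exprMn_comm _ comm_L23) mulrDr -(mulrA _ _ (L2 ^+ _)) -cX.
    by rewrite -(mulrA _ _ (L3 ^+ _)) -exprD mulrA -exprD subnKC.
  (* As b > 0, the factor 2^b makes the trivial character even for either parity of a - b. *)
  have b2 : exists2 m : int, 1 <= m & (2:int) ^+ b = 2 * m.
    by case: b b0 {ba ab} => // b _; exists (2 ^+ b); rewrite ?exprS ?exprn_ege1.
  have [m m1 bE] := b2.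
  have zy := zchar_L2M3X b.
  have [|[t zt [tE h]]|[zn n1 no]] := psum (a - b)%N.
    by rewrite subn_gt0 ltn_neqAle eq_sym ab.
    left; exists (2 ^+ b * t); first by have := zcharM zy zt; rewrite mulrN mulr0.
    by right; right; exists (m * t); rewrite bE mulrA.
  right; exists (2 ^+ b * (1 + 2 ^+ (a - b))), ((-1) ^+ b * 2); split; first exact: zcharM zy zn.
  by apply: Or41; exists (m * (1 + 2 ^+ (a - b))), ((-1) ^+ b); rewrite bE mulrA (mulrC _ 2).
rewrite andbT => /and3P[a0 b0 c0] _; rewrite mJM_3 //.
right; exists 0, 0; split; last by apply: Or41; exists 0, 0; rewrite !mulr0.
by have := zcharB zchar1 zchar1; rewrite !subrr.
Qed.

(** Exponents 1 and 2 keep explicit coordinates, because some of these pairs pass the test at xi = 0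
    and must be evaluated at xi = 1; larger exponents keep only a multiple of 8. *)
Lemma even_kind_cases z t d : even_kind z t d ->
  (exists t' d', t = 2 * t' /\ d = 2 * d') \/
  [\/ [/\ z = 1, t = 1 & d = 1],
      [/\ z = zcomb 3 (2 * 'X) (1 + 'X^2), t = 5 & d = 2] |
      exists m, [/\ 1 <= m, t = 1 + 8 * m & d = 2]] \/
  [\/ [/\ z = zcomb 0 0 1, t = 2 & d = -1],
      [/\ z = zcomb (2 + 'X^2) (3 * 'X + 'X^3) (1 + 4 * 'X^2 + 'X^4), t = 4 & d = 1] |
      exists m, [/\ 1 <= m, t = 8 * m & d = 1 \/ d = -1]].
Proof.
case=> [h|h|[n [-> -> -> n1 no]]|[n [-> -> -> n0]]].
- by left.
- by right; left; apply: Or31.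
- right; left; have [nE|nE|nE|[m m1 ->]] := pow2_cases n.
  + by rewrite nE in n1.
  + by rewrite nE in n1.
  + apply: Or32; split=> //; last by rewrite nE.
    rewrite nE power_sum_rec !expr0 !expr1 L2D3 zcomb1 zcombD.
    by rewrite !(zcombM hH) -scaleN1r zcombZ zcombD; congr zcomb; ring.
  + by apply: Or33; exists m.
right; right; have [nE|nE|nE|[m m1 ->]] := pow2_cases n.
- by rewrite nE in n0.
- by apply: Or31; rewrite nE !expr1.
- apply: Or32; rewrite nE !expr2 (zcombM hH); split=> //.
  by congr zcomb; ring.
- by apply: Or33; exists m; split=> //; rewrite -signr_odd; case: (odd n); [right|left].
Qed.

(** * Pairs and triples with unit determinant *)

Lemma even_pair a b c a' b' c' :
  even_kind (zcomb a b c) (a.[0] + 2 * c.[0]) (a.[0] - c.[0]) ->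
  even_kind (zcomb a' b' c') (a'.[0] + 2 * c'.[0]) (a'.[0] - c'.[0]) ->
  a * c' - a' * c \is a GRing.unit ->
  zcomb a b c = 1 /\ zcomb a' b' c' = zcomb 0 0 1 \/
  zcomb a b c = zcomb 0 0 1 /\ zcomb a' b' c' = 1.
Proof.
move=> k k' u.
have U n : a.[n] * c'.[n] - a'.[n] * c.[n] = 1 \/ a.[n] * c'.[n] - a'.[n] * c.[n] = -1.
  have := rmorph_unit (horner_eval n) u; rewrite /= /horner_eval !hornerE.
  by case/orP=> /eqP ->; [left|right].
(* Passing from (a, c) to the characters (a + 2 c, a - c) multiplies the 2 by 2 determinant by
   -3. *)
have U0 : (a.[0] + 2 * c.[0]) * (a'.[0] - c'.[0])
    - (a'.[0] + 2 * c'.[0]) * (a.[0] - c.[0]) = 3 \/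
  (a.[0] + 2 * c.[0]) * (a'.[0] - c'.[0])
    - (a'.[0] + 2 * c'.[0]) * (a.[0] - c.[0]) = -3.
  by have [U0|U0] := U 0; [right|left]; lia.
have U1 := U 1; clear U u; move: U0 U1 (even_kind_cases k) (even_kind_cases k') => {k k'}.
move: (a.[0] + 2 * c.[0]) (a.[0] - c.[0]) (a'.[0] + 2 * c'.[0]) (a'.[0] - c'.[0]).
move=> t d t' d' U0 U1.
case=> [[p [q [tE dE]]]|[[[zE tE dE]|[zE tE dE]|[m [m1 tE dE]]]|
  [[zE tE dE]|[zE tE dE]|[m [m1 tE dE]]]]].
all: case=> [[p' [q' [tE' dE']]]|[[[zE' tE' dE']|[zE' tE' dE']|[m' [m1' tE' dE']]]|
  [[zE' tE' dE']|[zE' tE' dE']|[m' [m1' tE' dE']]]]].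
all: try by [left|right].
(* The test at xi = 0 spares, up to order, only {1, m_2}, {1, y^2} and {m_2, y^2} besides the
   desired pair. Positivity of m matters: y with 1 + 8 m gives 5 + 8 m, which is -3 at m = -1. *)
all: try by exfalso; move: U0 {U1}; rewrite tE tE' ?dE ?dE'; lia.
(* The surviving pairs have known coordinates, and their determinants at xi = 1 are not units. *)
all: exfalso; move: zE zE' U1; rewrite ?zcomb1.
all: move=> /(zcomb_inj hH)[-> _ ->] /(zcomb_inj hH)[-> _ ->].
all: by rewrite !hornerE; case=> /eqP.
Qed.

Lemma Mxi_coords a b c : Mxi T (zcomb a b c) ->
  [/\ a.[0] = 0, c.[0] = 0 & b.[0] \is a GRing.unit -> zcomb a b c = zcomb 0 1 0] \/
  b.[0] = 0 /\ even_kind (zcomb a b c) (a.[0] + 2 * c.[0]) (a.[0] - c.[0]).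
Proof.
case/Mxi_cases => [[t /zcharP[tE sE dE] h]|[t [d [/zcharP[tE sE dE] h]]]].
  left; split; [lia|lia|case: h => [//|h] bu].
  by case/orP: bu => /eqP bE; case: h => [|[t']]; lia.
have b0 : b.[0] = 0 by lia.
by right; split=> //; move: h; rewrite tE dE b0 mulr0 addr0.
Qed.

(** At xi = 0 the first row is (0, b, 0), so b is a unit there and the first element is x. The
    determinant over Z[xi] is then, up to sign, the minor treated by [even_pair]. *)
Lemma odd_even_even a b c a' b' c' a'' b'' c'' :
  [/\ a.[0] = 0, c.[0] = 0 & b.[0] \is a GRing.unit -> zcomb a b c = zcomb 0 1 0] ->
  b'.[0] = 0 /\ even_kind (zcomb a' b' c') (a'.[0] + 2 * c'.[0]) (a'.[0] - c'.[0]) ->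
  b''.[0] = 0 /\ even_kind (zcomb a'' b'' c'') (a''.[0] + 2 * c''.[0]) (a''.[0] - c''.[0]) ->
  det_coords a b c a' b' c' a'' b'' c'' \is a GRing.unit ->
  [set zcomb a b c; zcomb a' b' c'; zcomb a'' b'' c''] =
  [set 1; zcomb 0 1 0; zcomb 0 0 1].
Proof.
move=> [a0 c0 zx] [b'0 k'] [b''0 k''] u.
have : zcomb a b c = zcomb 0 1 0.
  apply: zx; have := rmorph_unit (horner_eval 0) u.
  rewrite /= /horner_eval /det_coords !(hornerD, hornerM, hornerN) a0 c0 !mul0r add0r addr0.
  by rewrite unitrN unitrM => /andP[].
move=> zE; rewrite zE; move: u; have /(zcomb_inj hH)[-> -> ->] := zE.
rewrite /det_coords !mul0r add0r addr0 mul1r unitrN (mulrC c') => u.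
have [[-> ->]|[-> ->]] := even_pair k' k'' u; first by rewrite (setUC [set _] [set 1]).
by rewrite [in LHS]setUC [in LHS]setUA.
Qed.

(** At xi = 0 each row lies in the span of x or in that of 1 and y, so a nonzero determinant forces
    one row of the first type and two of the second. The position of the odd row is adjusted by a
    swap, which changes the sign, or by a cycle, which does not. *)
Lemma unit_triple a b c a' b' c' a'' b'' c'' :
  Mxi T (zcomb a b c) -> Mxi T (zcomb a' b' c') -> Mxi T (zcomb a'' b'' c'') ->
  det_coords a b c a' b' c' a'' b'' c'' \is a GRing.unit ->
  [set zcomb a b c; zcomb a' b' c'; zcomb a'' b'' c''] =
  [set 1; zcomb 0 1 0; zcomb 0 0 1].
Proof.
move=> m m' m'' u.
have u0 : (det_coords a b c a' b' c' a'' b'' c'').[0] != 0.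
  have := rmorph_unit (horner_eval 0) u; rewrite /= /horner_eval.
  by apply: contraTneq => ->; rewrite unitr0.
have zero : (det_coords a b c a' b' c' a'' b'' c'').[0] = 0 ->
  [set zcomb a b c; zcomb a' b' c'; zcomb a'' b'' c''] = [set 1; zcomb 0 1 0; zcomb 0 0 1].
  by move=> z0; rewrite z0 eqxx in u0.
have DE : (det_coords a b c a' b' c' a'' b'' c'').[0] =
   a.[0] * (b'.[0] * c''.[0] - c'.[0] * b''.[0]) - b.[0] * (a'.[0] * c''.[0] - c'.[0] * a''.[0])
   + c.[0] * (a'.[0] * b''.[0] - b'.[0] * a''.[0]).
  by rewrite /det_coords !(hornerD, hornerM, hornerN).
have [r|r] := Mxi_coords m; have [r'|r'] := Mxi_coords m'; have [r''|r''] := Mxi_coords m''.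
- by apply: zero; rewrite DE; case: r r' r'' => -> -> _ [-> -> _] [-> -> _]; ring.
- by apply: zero; rewrite DE; case: r r' r'' => -> -> _ [-> -> _] [-> _]; ring.
- by apply: zero; rewrite DE; case: r r' r'' => -> -> _ [-> _] [-> -> _]; ring.
- exact: odd_even_even.
- by apply: zero; rewrite DE; case: r r' r'' => -> _ [-> -> _] [-> -> _]; ring.
- rewrite (setUC [set zcomb a b c]); apply: odd_even_even => //.
  by move: u; rewrite -unitrN; congr (_ \is a GRing.unit); rewrite /det_coords; ring.
- rewrite setUC setUA; apply: odd_even_even => //.
  by move: u; congr (_ \is a GRing.unit); rewrite /det_coords; ring.
- by apply: zero; rewrite DE; case: r r' r'' => -> _ [-> _] [-> _]; ring.
Qed.

(** * The reference basis of the centre and the conclusion *)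

Definition zbasis (i : 'I_3) : H := nth 0 [:: 1; zcomb 0 1 0; zcomb 0 0 1] i.

Lemma zbasis_sum (c : 'I_3 -> R) :
  \sum_i c i *: zbasis i = zcomb (c (inord 0)) (c (inord 1)) (c (inord 2)).
Proof.
rewrite !big_ord_recl big_ord0 addr0 /zbasis /= zcomb1 !zcombZ !zcombD.
rewrite !(mulr0, mulr1, add0r, addr0).
by congr (zcomb (c _) (c _) (c _)); apply: val_inj; rewrite /= inordK.
Qed.

Lemma range_zbasis : range zbasis = [set 1; zcomb 0 1 0; zcomb 0 0 1].
Proof.
apply/seteqP; split=> [_ [i _ <-]|v [[->|->]|->]] /=.
- by case: (ord3P i) => ->; rewrite /zbasis inordK //=; [left; left|left; right|right].
- by exists (inord 0); rewrite // /zbasis inordK.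
- by exists (inord 1); rewrite // /zbasis inordK.
- by exists (inord 2); rewrite // /zbasis inordK.
Qed.

Lemma zbasis_free (c : 'I_3 -> R) : \sum_i c i *: zbasis i = 0 -> forall i, c i = 0.
Proof.
have z0 : 0 = zcomb 0 0 0 by rewrite -(scale0r (zcomb 0 0 0)) zcombZ !mul0r.
rewrite zbasis_sum z0 => /(zcomb_inj hH)[c0 c1 c2] i.
by case: (ord3P i) => ->.
Qed.

End Mxi.

Theorem theorem6p11 (H : algType {poly int}) (T : 'S_3 -> H) (hH : hecke3 T)
    (B : set H) :
  (B `<=` Mxi T /\ is_basis B (ring_center H)) <->
  B = [set mJM T [::]; mJM T [:: 1%N]; mJM T [:: 1%N; 1%N]].
Proof.
have BME : [set mJM T [::]; mJM T [:: 1%N]; mJM T [:: 1%N; 1%N]] = range (zbasis (T := T)).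
  by rewrite range_zbasis mJM_nil mJM_1 // mJM_2 // eqxx !expr1 L2D3 (L2M3 hH).
have center i : ring_center H (zbasis (T := T) i).
  rewrite -sum_delta zbasis_sum; exact: zcomb_center.
have span v : ring_center H v -> exists c, v = \sum_i c i *: zbasis (T := T) i.
  move=> /(centerP hH)[a [b [c ->]]]; exists (fun i : 'I_3 => nth 0 [:: a; b; c] i).
  by rewrite zbasis_sum !inordK.
rewrite BME; split=> [[BM Bbasis]|->].
  (* [B] turns out to consist of three elements, whose coordinates are the rows of an invertible
     [P]; [unit_triple] then identifies the set. *)
  have [z [P [zB Pdet zE]]] := basis_change _ _ _ _ _ _ (zbasis_free hH) center span Bbasis.
  have {}zE j : z j = zcomb (T := T) (P j (inord 0)) (P j (inord 1)) (P j (inord 2)).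
    by rewrite zE zbasis_sum.
  have zM j : Mxi T (z j) by apply: BM; rewrite zB; exists j.
  move: Pdet; rewrite unitmxE det3 => Pdet.
  have := zM (inord 0); have := zM (inord 1); have := zM (inord 2).
  rewrite !zE => m2 m1 m0; rewrite range_zbasis -(unit_triple hH m0 m1 m2 Pdet) -!zE zB.
  apply/seteqP; split=> [_ [i _ <-]|v].
    by case: (ord3P i) => ->; [left; left|left; right|right].
  by move=> [[]|] ->; eexists.
split; last exact: free_is_basis (zbasis_free hH) center span.
by rewrite -BME => _ [[]|] ->; [exists [::]|exists [:: 1%N]|exists [:: 1%N; 1%N]].
Qed.
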